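(* Let $n\ge1$ and let $\mathbf R=(R,+,\cdot,1)$ be a unitary commutative ring of characteristic $2$ satisfying $x^{2^n}=x$ for all $x\in R$. Then there exists a binary term operation $\wedge$ on $R$ such that $(R,\vee,\wedge,{}',0,1)$ is a Boolean algebra, where $x\vee y:=x+y+(x\wedge y)$ and $x':=x+1$ for all $x,y\in R$.
   Context: A ring is of characteristic $2$ if $x+x=0$ for all its elements $x$. A binary term operation on $R$ is a binary operation on $R$ induced by a term in two variables in the language of unitary rings, i.e. of the form $(x,y)\mapsto p(x,y)$ for some polynomial $p$ in two commuting variables with integer coefficients (equivalently here, coefficients in $\{0,1\}$). A Boolean algebra is a bounded distributive lattice $(L,\vee,\wedge,{}',0,1)$ with complementation $'$ ($x\vee x'=1$, $x\wedge x'=0$); the one-element algebra is allowed. *)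

(* Defs.v *)
From HB Require Import structures.
From mathcomp Require Import all_boot all_order all_algebra.

Set Implicit Arguments.
Unset Strict Implicit.
Unset Printing Implicit Defensive.

Import Order.TTheory GRing.Theory.

Local Open Scope ring_scope.

(* MathComp's GRing.term lives over a nontrivial ring with a computable unit
   test and has constants and inverses; the terms below have none of these. *)
Inductive ring_term (k : nat) : Type :=
  | TVar of 'I_k
  | TZero
  | TOne
  | TOpp of ring_term k
  | TAdd of ring_term k & ring_term k
  | TMul of ring_term k & ring_term k.

Arguments TZero {k}.
Arguments TOne {k}.

Fixpoint eval_term (k : nat) (R : pzRingType) (e : k.-tuple R)
    (t : ring_term k) : R :=
  match t with
  | TVar i => tnth e i
  | TZero => 0
  | TOne => 1
  | TOpp t1 => - eval_term e t1
  | TAdd t1 t2 => eval_term e t1 + eval_term e t2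
  | TMul t1 t2 => eval_term e t1 * eval_term e t2
  end.

Definition is_binary_term_operation (R : pzRingType) (f : R -> R -> R) : Prop :=
  exists t : ring_term 2, forall x y : R, f x y = eval_term [tuple x; y] t.

(* The operations are those of some library Boolean algebra with carrier T
   itself; the display d has no mathematical content, and T may be a
   singleton. *)
Definition is_boolean_algebra (T : Type) (join meet : T -> T -> T)
    (compl : T -> T) (bot top : T) : Prop :=
  exists (d : Order.disp_t) (c : Order.CTBDistrLattice.axioms_ d T),
    let L : ctbDistrLatticeType d := Order.CTBDistrLattice.Pack c in
    [/\ forall x y : L, (x `|` y)%O = join x y,
        forall x y : L, (x `&` y)%O = meet x y,
        forall x : L, (~` x)%O = compl x,
        (\bot : L)%O = bot
      & (\top : L)%O = top].

(* Main.v *)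
Require Import Defs.
From HB Require Import structures.
From mathcomp Require Import all_boot all_order all_algebra all_field ssrAC.
From Stdlib Require Import Classical.

(** If [(a_i)] is a basis of the field [F] with [2 ^ n] elements over [F_2] that
    is permuted cyclically by the Frobenius map, with sum 1, the coordinatewise
    product in this basis makes [(F, +)] a Boolean ring with unit 1.  In terms of
    the trace-dual basis [(b_i)] that product is
    [x /\ y = \sum_(j, k) Tr (a_0 b_j b_k) x^(2^j) y^(2^k)], a polynomial with
    coefficients in [F_2].  The laws of a Boolean ring amount to identities
    between these coefficients, because [x^(2^i)] is additive and periodic in
    [i] modulo [n]; hence they hold in every commutative ring of characteristic 2
    with [x^(2^n) = x].

    The basis exists because [F] is a cyclic [F_2[X]]-module for [X] acting as
    the Frobenius map: its annihilator is generated by [X^n - 1], since a nonzero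
    linearized polynomial of degree at most [2^(n-1)] cannot vanish on [F]. *)

Set Implicit Arguments.
Unset Strict Implicit.
Unset Printing Implicit Defensive.

Import GRing.Theory FalgLfun.

Local Open Scope ring_scope.

(** * Frobenius powers in characteristic 2 *)

Definition frob (R : pzSemiRingType) (i : nat) (x : R) : R := x ^+ (2 ^ i).

Section Frobenius.

Variables (R : comPzRingType) (char2 : forall x : R, x + x = 0).
Implicit Types x y : R.

Lemma frob0 i : frob i (0 : R) = 0.
Proof. by rewrite /frob expr0n expn_eq0. Qed.

Lemma frob1 i : frob i (1 : R) = 1.
Proof. exact: expr1n. Qed.

Lemma frobM i x y : frob i (x * y) = frob i x * frob i y.
Proof. exact: exprMn. Qed.

Lemma frob_comp i j x : frob j (frob i x) = frob (i + j) x.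
Proof. by rewrite /frob -exprM -expnD. Qed.

Lemma frobD i x y : frob i (x + y) = frob i x + frob i y.
Proof.
rewrite /frob; elim: i => // i IHi.
by rewrite expnSr !exprM IHi sqrrD mulr2n char2 addr0.
Qed.

Lemma frob_sum I r (P : pred I) i (F : I -> R) :
  frob i (\sum_(k <- r | P k) F k) = \sum_(k <- r | P k) frob i (F k).
Proof. by apply: big_morph; [exact: frobD | exact: frob0]. Qed.

(** Parity is what passes from the finite field to a general [R]: coefficients that agree modulo 2
    can be exchanged in any ring of characteristic 2. *)
Lemma mulrn_odd x k : x *+ k = x *+ odd k.
Proof.
by rewrite -[k in LHS]odd_double_half mulrnDr -muln2 mulrnA mulr2n char2 addr0.
Qed.

Lemma natr_odd k : k%:R = (odd k)%:R :> R.
Proof. exact: mulrn_odd. Qed.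

Lemma frobMn i x k : frob i (x *+ k) = frob i x *+ k.
Proof.
rewrite mulrn_odd [RHS]mulrn_odd.
by case: odd; rewrite ?mulr1n // !mulr0n frob0.
Qed.

Variables (m : nat) (expR : forall x, x ^+ (2 ^ m.+1) = x).
Implicit Types i j : 'I_m.+1.

Lemma frob_mod k x : frob (k %% m.+1) x = frob k x.
Proof.
rewrite [in RHS](divn_eq k m.+1) addnC -frob_comp.
elim: (k %/ m.+1)%N => [|q IHq]; first by rewrite mul0n /frob expn0 expr1.
by rewrite mulSn addnC -frob_comp -IHq /frob expR.
Qed.

(** The sum on the left is taken modulo [m.+1]. Frobenius powers are thus indexed by a cyclic group,
    and sums over them can be reindexed by translations. *)
Lemma frob_add i j x : frob (i + j)%R x = frob j (frob i x).
Proof. by rewrite frob_comp /= frob_mod. Qed.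

(** For [m = 0] the index [Zp1] is 0, but then [expR] already says that every element is
    idempotent. *)
Lemma frob_Zp1 x : frob (Zp1 : 'I_m.+1) x = x * x.
Proof. by rewrite /= frob_mod /frob expn1 expr2. Qed.

End Frobenius.

(** * Orders of elements in torsion modules over [K[X]] *)

Lemma irreducible_factor (K : fieldType) (h : {poly K}) :
  (1 < size h)%N -> exists2 p, irreducible_poly p & p %| h.
Proof.
have [s] := ubnP (size h); elim: s h => // s IHs h /ltnSE-le_hs h_gt1.
(* Irreducibility over an arbitrary field is not decidable, so the case split is classical. *)
case: (classic (irreducible_poly h)) => [irr_h | ]; first by exists h.
move=> /not_and_or[/(_ h_gt1)[] | red_h].
have h_neq0 : h != 0 by rewrite -size_poly_gt0 ltnW.
have [q q_red] := not_all_ex_not _ _ red_h.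
have [q_neq1 {}q_red] := imply_to_and _ _ q_red.
have [q_dv_h q_neq_h] := imply_to_and _ _ q_red.
have q_neq0 : q != 0 by apply: contraNneq h_neq0 => q0; rewrite -dvd0p -q0.
have [||p irr_p p_dv_q] := IHs q; last first.
- by exists p => //; apply: dvdp_trans q_dv_h.
- by rewrite ltn_neqAle eq_sym q_neq1 size_poly_gt0.
apply: leq_trans le_hs; rewrite ltn_neqAle dvdp_leq // andbT.
by apply: contra_notN q_neq_h; rewrite dvdp_size_eqp.
Qed.

Lemma irreducible_power_part (K : fieldType) (p q : {poly K}) :
    irreducible_poly p -> q != 0 ->
  exists k r, [/\ q = p ^+ k * r, coprimep p r & r != 0].
Proof.
move=> irr_p; have [s] := ubnP (size q).
elim: s q => // s IHs q /ltnSE-le_qs q_neq0.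
have [p_dv_q | p_ndv_q] := boolP (p %| q); last first.
  exists 0%N, q; rewrite expr0 mul1r; split=> //.
  apply: contraR p_ndv_q => p_ncop_q.
  by rewrite -(eqp_dvdl _ (irr_p _ p_ncop_q (dvdp_gcdl p q))) dvdp_gcdr.
have /dvdpP[q1 Dq] := p_dv_q; have p_gt1 := irr_p.1.
have q1_neq0 : q1 != 0 by apply: contraNneq q_neq0 => q10; rewrite Dq q10 mul0r.
have [|k [r [Dq1 cop r_neq0]]] := IHs q1 _ q1_neq0.
  apply: leq_trans le_qs; rewrite Dq size_mul ?(irredp_neq0 irr_p) //.
  rewrite -subn1 -addnBA ?(ltnW p_gt1) // -[X in (X < _)%N]addn0.
  by rewrite ltn_add2l subn_gt0.
by exists k.+1, r; rewrite Dq Dq1 exprS mulrC mulrA.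
Qed.

Section CyclicModule.

Variables (K : fieldType) (V : lmodType {poly K}).
Implicit Types (p q h : {poly K}) (x v : V).

(** Write [q = p ^+ j * r] with [r] coprime to [p]. By Bezout [r] acts invertibly on what
    [p ^+ k.+1] kills, so [p ^+ j] already kills [v], which forces [j > k]. *)
Lemma irreducible_power_order p k v :
    irreducible_poly p -> p ^+ k.+1 *: v = 0 -> p ^+ k *: v != 0 ->
  forall q, q *: v = 0 -> p ^+ k.+1 %| q.
Proof.
move=> irr_p pSk_v pk_v q q_v.
have [-> | q_neq0] := eqVneq q 0; first exact: dvdp0.
have [j [r [Dq cop_pr _]]] := irreducible_power_part irr_p q_neq0.
have [lt_kj | le_jk] := ltnP k j; first by rewrite Dq dvdp_mulr // dvdp_exp2l.
case/eqP: pk_v; rewrite -(subnK le_jk) exprD -scalerA.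
suffices ->: p ^+ j *: v = 0 by rewrite scaler0.
have /Bezout_eq1_coprimepP[[u w] /= uw1] : coprimep (p ^+ k.+1) r.
  exact: coprimep_expl.
rewrite -[LHS]scale1r -uw1 scalerDl -!scalerA (scalerA r) (mulrC r) -Dq q_v.
by rewrite scaler0 addr0 (scalerA (p ^+ _)) mulrC -scalerA pSk_v !scaler0.
Qed.

(* If [N = p ^+ k.+1 * r], some [r *: x] is not killed by [p ^+ k]; the sum of
   such elements over the primary factors of [N] has order [N]. *)
Lemma exists_order_annihilator (N : {poly K}) :
    N != 0 -> (forall x, N *: x = 0) ->
    (forall q, (forall x, q *: x = 0) -> N %| q) ->
  exists v, forall q, q *: v = 0 -> N %| q.
Proof.
move=> N_neq0 N_ann N_gen.
suffices [v [_ ord_v]] : exists v, N *: v = 0 /\ forall q, q *: v = 0 -> N %| q.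
  by exists v.
(* Generalising from [N] to its divisors [h] lets the induction strip off one primary factor at a
   time, while [N] remains the annihilator of the module. *)
have: N %| N by []; move: {1 3 4}N => h.
have [s] := ubnP (size h); elim: s h => // s IHs h /ltnSE-le_hs h_dv_N.
have h_neq0 : h != 0 by apply: contraNneq N_neq0 => h0; rewrite -dvd0p -h0.
have [h_le1 | h_gt1] := leqP (size h) 1.
  exists 0; split=> [|q _]; first exact: scaler0.
  rewrite (eqp_dvdl _ (_ : h %= 1)) ?dvd1p // -size_poly_eq1 eqn_leq h_le1.
  by rewrite size_poly_gt0.
have [p irr_p p_dv_h] := irreducible_factor h_gt1.
have [[|k] [h' [Dh cop_ph' h'_neq0]]] := irreducible_power_part irr_p h_neq0.
  have := irr_p.1; rewrite -(eqP (_ : size p == 1%N)) ?ltnn //.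
  by rewrite -coprimepp (coprimep_dvdl p_dv_h) // Dh expr0 mul1r.
have cop : coprimep (p ^+ k.+1) h' by exact: coprimep_expl.
have p_neq0 := irredp_neq0 irr_p.
have [||v1 [h'_v1 ord_v1]] := IHs h'.
- apply: leq_trans le_hs; rewrite Dh size_mul ?expf_neq0 //.
  rewrite -subn1 addnC -addnBA ?size_poly_gt0 ?expf_neq0 //.
  rewrite -[X in (X < _)%N]addn0 ltn_add2l subn_gt0.
  apply: leq_trans irr_p.1 _.
  rewrite exprS size_mul ?expf_neq0 // -subn1 -addnBA.
    by rewrite leq_addr.
  by rewrite size_poly_gt0 expf_neq0.
- by apply: dvdp_trans h_dv_N; rewrite Dh dvdp_mull.
have /dvdpP[r DN] : p ^+ k.+1 %| N.
  by apply: dvdp_trans h_dv_N; rewrite Dh dvdp_mulr.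
have r_neq0 : r != 0 by apply: contraNneq N_neq0 => r0; rewrite DN r0 mul0r.
(* Otherwise [p ^+ k * r], a proper divisor of [N = r * p ^+ k.+1], would annihilate the whole
   module. *)
have [x /eqP x_ord] : exists x, p ^+ k * r *: x <> 0.
  apply: not_all_ex_not => /N_gen; rewrite DN mulrC dvdp_mul2r // exprS.
  rewrite -[X in _ %| X]mul1r dvdp_mul2r ?expf_neq0 // dvdp1 => /eqP p1.
  by have := irr_p.1; rewrite p1.
rewrite -scalerA in x_ord.
have rx_killed : p ^+ k.+1 *: (r *: x) = 0 by rewrite scalerA mulrC -DN.
exists (v1 + r *: x); split=> [|q].
  rewrite Dh scalerDr mulrC -[_ *: (r *: x)]scalerA rx_killed scaler0 addr0.
  by rewrite mulrC -scalerA h'_v1 scaler0.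
(* Multiplying [q_v] by [h'] kills the summand [v1], and multiplying it by [p ^+ k.+1] kills
   [r *: x]; coprimality then removes the multiplier. *)
move=> q_v; rewrite Dh Gauss_dvdp //; apply/andP; split.
  rewrite -(Gauss_dvdpl q cop).
  apply: (irreducible_power_order irr_p rx_killed x_ord).
  have := congr1 (fun v => h' *: v) q_v.
  by rewrite /= scaler0 scalerA mulrC scalerDr -scalerA h'_v1 scaler0 add0r.
rewrite -(Gauss_dvdpl q (_ : coprimep h' (p ^+ k.+1))) 1?coprimep_sym //.
apply: ord_v1; have := congr1 (fun v => p ^+ k.+1 *: v) q_v.
rewrite /= scaler0 scalerA mulrC scalerDr -[_ *: (r *: x)]scalerA rx_killed.
by rewrite scaler0 addr0.
Qed.

End CyclicModule.

(** * Normal elements and trace-dual bases of a finite field *)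

Section DualNormalBasis.

Variables (F : finFieldType) (pcharF : 2 \in [pchar F]) (m : nat).
Hypothesis card_F : #|F| = (2 ^ m.+1)%N.
Implicit Types (x y : F) (i j k l : 'I_m.+1).

Lemma pchar2_addrr x : x + x = 0.
Proof. by rewrite addrr_pchar2. Qed.

Lemma finField_expX x : x ^+ (2 ^ m.+1) = x.
Proof. by rewrite -card_F expf_card. Qed.

Local Notation FD := (frobD pchar2_addrr).
Local Notation Fsum := (frob_sum pchar2_addrr).
Local Notation Fadd := (frob_add finField_expX).

(** As a polynomial in [x] the sum has degree at most [2 ^ m], fewer than its [2 ^ m.+1] roots. *)
Lemma linearized_poly_eq0 (u : 'I_m.+1 -> F) :
  (forall x, \sum_j u j * frob j x = 0) -> forall j, u j = 0.
Proof.
move=> u0 j; pose P := \sum_k u k *: 'X^(2 ^ k).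
have coefP : P`_(2 ^ j) = u j.
  rewrite coef_sum (bigD1 j) //= coefZ coefXn eqxx mulr1 big1 ?addr0 //.
  move=> k k_neq_j.
  by rewrite coefZ coefXn eqn_exp2l // val_eqE eq_sym (negPf k_neq_j) mulr0.
have sizeP : (size P <= (2 ^ m).+1)%N.
  apply: leq_trans (size_sum _ _ _) _; apply/bigmax_leqP => k _.
  rewrite (leq_trans (size_scale_leq _ _)) // size_polyXn ltnS.
  by rewrite leq_exp2l // -ltnS.
have [P0 | P_neq0] := eqVneq P 0; first by rewrite -coefP P0 coef0.
have rootsP : all (root P) (enum F).
  apply/allP => x _; rewrite /root horner_sum -[X in _ == X](u0 x).
  by apply/eqP/eq_bigr => k _; rewrite hornerZ hornerXn.
have := max_poly_roots P_neq0 rootsP (enum_uniq F).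
rewrite -cardE card_F => /leq_trans/(_ sizeP).
by rewrite ltnS leq_exp2l // ltnn.
Qed.

Lemma exists_normal_element :
  exists a : F, forall c : {ffun 'I_m.+1 -> 'F_2},
    \sum_j (c j : nat)%:R * frob j a = 0 -> c = 0.
Proof.
(* [L] is [F] as an algebra over [F_2], for which the Frobenius map is linear; [act p] below is the
   value of [p] at this map. *)
pose L := pPrimeCharType pcharF.
have phi_lin : linear (frob 1 : L -> L).
  move=> c x y; rewrite FD; congr (_ + _).
  by rewrite /GRing.scale /= /pprimeChar_scale !mulr_natl (frobMn pchar2_addrr).
pose phiL := GRing.isLinear.Build _ _ _ _ _ phi_lin.
pose phi_linear : {linear L -> L} := HB.pack (frob 1 : L -> L) phiL.
pose phi : 'End(L) := linfun phi_linear.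
pose act (p : {poly 'F_2}) (x : F) : F := horner_alg phi p (x : L).
have phiX (k : nat) (x : L) : (phi ^+ k) x = frob k x.
  elim: k x => [|k IHk] x; first by rewrite expr0 id_lfunE /frob expn0 expr1.
  by rewrite exprS lfun_mulE IHk lfunE /= frob_comp.
have actE (p : {poly _}) x : (size p <= m.+1)%N ->
    act p x = \sum_(j < m.+1) (nat_of_ord p`_j)%:R * frob j x.
  move=> le_p; rewrite /act.
  have Dp : p = \sum_(j < m.+1) p`_j *: 'X^j.
    rewrite -poly_def; apply/polyP => i; rewrite coef_poly.
    by case: ltnP => // le_m_i; rewrite nth_default // (leq_trans le_p).
  rewrite [in LHS]Dp raddf_sum sum_lfunE; apply: eq_bigr => j _.
  rewrite /= linearZ /= rmorphXn /= horner_algX.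
  by rewrite mulr_algl scale_lfunE phiX.
have actA p q x : act p (act q x) = act (p * q) x.
  by rewrite /act mulrC rmorphM lfun_mulE.
have act1 : left_id 1 act by move=> x; rewrite /act rmorph1 id_lfunE.
have actDr : right_distributive act +%R by move=> p x y; rewrite /act linearD.
have actDl x : {morph act^~ x : p q / p + q}.
  by move=> p q; rewrite /act rmorphD add_lfunE.
pose modV := GRing.Zmodule_isLmodule.Build {poly 'F_2} F actA act1 actDr actDl.
pose V : lmodType {poly 'F_2} := HB.pack (F : Type) (GRing.Zmodule.on F) modV.
(* Polynomials of degree at most [m] act as linearized polynomials, so only 0 acts trivially. This
   is applied to remainders modulo [N]. *)
have small_eq0 (p : {poly _}) :
    (size p <= m.+1)%N -> (forall x, act p x = 0) -> p = 0.
  move=> le_p p0.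
  have c0 := linearized_poly_eq0
    (fun x => etrans (esym (actE p x le_p)) (p0 x)).
  apply/polyP => i; rewrite coef0.
  have [lt_i | le_i] := ltnP i m.+1; last first.
    by rewrite nth_default // (leq_trans le_p).
  have /eqP := c0 (Ordinal lt_i); rewrite /= -(dvdn_pcharf pcharF) => two_dv.
  by apply: ord_inj; apply/eqP; rewrite -[eqbLHS](@modn_small _ 2) //.
pose N : {poly 'F_2} := 'X^(m.+1) - 1.
have sizeN : size N = m.+2 by rewrite size_XnsubC.
have N_neq0 : N != 0 by rewrite -size_poly_eq0 sizeN.
have N_ann (x : V) : N *: x = 0.
  rewrite /GRing.scale /= /act rmorphB rmorphXn /= horner_algX rmorph1.
  by rewrite add_lfunE opp_lfunE id_lfunE phiX /frob finField_expX subrr.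
have N_gen (q : {poly 'F_2}) : (forall x : V, q *: x = 0) -> N %| q.
  move=> q0; apply/modp_eq0P/small_eq0; first by rewrite -ltnS -sizeN ltn_modp.
  move=> x; have := q0 x; rewrite {1}(divp_eq q N) scalerDl -scalerA N_ann.
  by rewrite scaler0 add0r.
have [a ord_a] := exists_order_annihilator N_neq0 N_ann N_gen.
(* A relation [c] between the conjugates of [a] is a polynomial of degree at most [m] killing [a];
   being a multiple of [N], it is zero. *)
exists a => c c_a0; pose p := \poly_(j < m.+1) c (inord j).
have le_p : (size p <= m.+1)%N by exact: size_poly.
have /ord_a : p *: a = 0.
  rewrite -[LHS]/(act p a) actE // -[RHS]c_a0; apply: eq_bigr => j _.
  by rewrite coef_poly ltn_ord inord_val.
have [p0 _ | p_neq0 /(dvdp_leq p_neq0)] := eqVneq p 0; last first.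
  by rewrite sizeN ltnNge le_p.
apply/ffunP => j; have := congr1 (fun q : {poly 'F_2} => q`_j) p0.
by rewrite /= coef_poly ltn_ord inord_val coef0 ffunE.
Qed.

Lemma natF2B (c d : 'F_2) :
  (nat_of_ord (c - d)%R)%:R = (c : nat)%:R - (d : nat)%:R :> F.
Proof.
have opp x : - x = x by apply/eqP; rewrite eq_sym -addr_eq0 pchar2_addrr.
rewrite opp -natrD natr_odd; last exact: pchar2_addrr.
rewrite [RHS]natr_odd; last exact: pchar2_addrr.
by case: c d => [[|[|?]] // ?] [[|[|?]] // ?].
Qed.

(** The sum is the trace of [b * frob j a]. The conjugates of [b] come from inverting the matrix of
    conjugates of a normal element [a]. *)
Lemma exists_dual_normal_basis : exists a b : F,
  forall j, \sum_(l < m.+1) frob l b * frob (l + j)%R a = (j == 0)%:R.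
Proof.
have [a a_free] := exists_normal_element.
pose comb (c : {ffun 'I_m.+1 -> 'F_2}) := \sum_j (c j : nat)%:R * frob j a.
have comb_inj : injective comb.
  move=> c d eq_cd; apply/eqP; rewrite -subr_eq0; apply/eqP/a_free.
  transitivity (comb c - comb d); last by rewrite eq_cd subrr.
  rewrite /comb -sumrB; apply: eq_bigr => j _; rewrite -mulrBl; congr (_ * _).
  by rewrite !ffunE natF2B.
(* There are as many coefficient vectors as elements of [F], so the injective [comb] is onto. *)
have comb_onto x : exists c, x = comb c.
  have le_card : (#|F| <= #|{ffun 'I_m.+1 -> 'F_2}|)%N.
    by rewrite card_ffun card_F card_Fp // card_ord.
  have [g _ gK] := inj_card_bij comb_inj le_card.
  by exists (g x).
pose M : 'M[F]_m.+1 := \matrix_(i, j) frob (i + j)%R a.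
(* If [u *m M = 0], the linearized polynomial with coefficients [u] vanishes on all conjugates of
   [a], hence on their span [F]. *)
have M_unit : M \in unitmx.
  rewrite -row_free_unit; apply: inj_row_free => u uM0.
  apply/rowP => j; rewrite mxE; apply: linearized_poly_eq0 j => x.
  have [c ->] := comb_onto x.
  transitivity (\sum_i (c i : nat)%:R * (u *m M) 0 i); last first.
    by rewrite uM0 big1 // => i _; rewrite mxE mulr0.
  under eq_bigr => j _ do rewrite Fsum mulr_sumr.
  rewrite exchange_big; apply: eq_bigr => i _; rewrite mxE mulr_sumr.
  apply: eq_bigr => j _; rewrite mxE addrC Fadd !mulr_natl.
  by rewrite (frobMn pchar2_addrr) mulrnAr.
have [w wM] : exists w : 'rV[F]_m.+1 , w *m M = delta_mx 0 0.
  by exists (delta_mx 0 0 *m invmx M); rewrite mulmxKV.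
have wE j : \sum_(l < m.+1) w 0 l * frob (l + j)%R a = (j == 0)%:R.
  have := congr1 (fun v : 'rV_m.+1 => v 0 j) wM; rewrite !mxE eqxx /= => <-.
  by apply: eq_bigr => l _; rewrite [M _ _]mxE.
(* Applying the Frobenius map to the system [w *m M = e_0] and shifting the
   indices gives the same system back. *)
have w_shift l : w 0 (l + Zp1)%R = frob (Zp1 : 'I_m.+1) (w 0 l).
  pose w' : 'rV[F]_m.+1 := \row_l frob (Zp1 : 'I_m.+1) (w 0 (l - Zp1)%R).
  suffices /rowP/(_ (l + Zp1)%R) -> : w = w' by rewrite [LHS]mxE addrK.
  rewrite -[LHS](mulmxK M_unit) -[RHS](mulmxK M_unit); congr (_ *m _).
  apply/rowP => j; rewrite [LHS]mxE [RHS]mxE.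
  transitivity
      (frob (Zp1 : 'I_m.+1) (\sum_(k < m.+1) w 0 k * frob (k + j)%R a)).
    under eq_bigr do rewrite [M _ _]mxE.
    by rewrite wE; case: eqP; rewrite ?frob0 ?frob1.
  rewrite Fsum [RHS](reindex_inj (addIr Zp1)); apply: eq_bigr => k _.
  by rewrite [w' _ _]mxE [M _ _]mxE addrK frobM -Fadd addrAC.
(* By iterating [w_shift], the entries of [w] are the conjugates of [w 0 0]. *)
exists a, (w 0 0) => j; rewrite -wE; apply: eq_bigr => l _; congr (_ * _).
have w_frob (k : nat) : w 0 (inZp k) = frob k (w 0 0).
  elim: k => [|k IHk].
    by rewrite /frob expn0 expr1; congr (w 0 _); apply: val_inj.
  have -> : inZp k.+1 = inZp k + Zp1 :> 'I_m.+1.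
    by apply: val_inj; rewrite /= modnDm addn1.
  by rewrite w_shift IHk (frob_mod finField_expX) frob_comp addn1.
by rewrite -w_frob valZpK.
Qed.

End DualNormalBasis.

(** * Coefficients of the meet *)

(* With [tr] the absolute trace of the field with [2 ^ m.+1] elements and with
   [a], [b] generating dual normal bases, [c j k = tr (a * frob j b * frob k b)]. *)
Lemma exists_meet_coefficients (m : nat) :
  exists c : 'I_m.+1 -> 'I_m.+1 -> nat,
  [/\ forall j k, c j k = c k j,
      forall j, odd (\sum_k c j k) = (j == 0),
      forall j, odd (c j j) = (j + Zp1 == 0)
    & forall j k l, odd (\sum_i c i l * c (j - i)%R (k - i)%R) =
                    odd (\sum_i c i j * c (k - i)%R (l - i)%R)].
Proof.
have [F pcharF card_F] := pPrimePowerField (isT : prime 2) (ltn0Sn m).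
have char2 := pchar2_addrr pcharF; have expF := finField_expX card_F.
have [a [b dual]] := exists_dual_normal_basis pcharF card_F.
have Fadd := frob_add expF; have Fsum := frob_sum char2.
pose tr (x : F) := \sum_(i < m.+1) frob i x.
(* Squaring permutes the summands of the trace, so traces are idempotent, hence 0 or 1. *)
have tr_fix x : tr x * tr x = tr x.
  rewrite -(frob_Zp1 expF) Fsum [RHS](reindex_inj (addIr Zp1)).
  by apply: eq_bigr => i _; rewrite Fadd.
have tr01 x : tr x = (tr x == 1)%:R.
  have /eqP: tr x * (tr x - 1) = 0 by rewrite mulrBr tr_fix mulr1 subrr.
  rewrite mulf_eq0 subr_eq0 => /orP[] /eqP->; rewrite ?eqxx //.
  by rewrite eq_sym oner_eq0.
have frob_tr i x : frob i (tr x) = tr x.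
  by rewrite (tr01 x); case: eqP; rewrite ?frob0 ?frob1.
have trD x y : tr (x + y) = tr x + tr y.
  by rewrite -big_split; apply: eq_bigr => i _; rewrite (frobD char2).
have tr_sum I r (P : pred I) (f : I -> F) :
    tr (\sum_(i <- r | P i) f i) = \sum_(i <- r | P i) tr (f i).
  by apply: big_morph; [exact: trD | rewrite /tr big1 // => i _; rewrite frob0].
have trMl x y : tr (tr x * y) = tr x * tr y.
  by rewrite mulr_sumr; apply: eq_bigr => i _; rewrite frobM frob_tr.
have tr_frob (i : 'I_m.+1) x : tr (frob i x) = tr x.
  by rewrite [RHS](reindex_inj (addrI i)); apply: eq_bigr => k _; rewrite Fadd.
have pairing (k : 'I_m.+1) : tr (a * frob k b) = (k == 0)%:R.
  rewrite -oppr_eq0 -dual [RHS](reindex_inj (addrI k)).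
  by apply: eq_bigr => i _; rewrite frobM -Fadd mulrC addrAC subrr add0r.
(* Expansion of [x] in the conjugates of [b]: after exchanging the sums, the coefficient of
   [frob j x] is the sum in [dual]. *)
have expand x : \sum_(i < m.+1) frob i b * tr (frob i a * x) = x.
  under eq_bigr do rewrite mulr_sumr.
  rewrite exchange_big (bigD1 0) //= [X in _ + X]big1 => [|j /negPf j_neq0].
    transitivity ((0 == 0 :> 'I_m.+1)%:R * x); last by rewrite eqxx mul1r.
    rewrite addr0 -dual mulr_suml; apply: eq_bigr => i _.
    by rewrite addr0 -mulrA /frob expn0 !expr1.
  transitivity ((j == 0)%:R * frob j x); last by rewrite j_neq0 mul0r.
  rewrite -dual mulr_suml; apply: eq_bigr => i _.
  by rewrite frobM -Fadd mulrA.
(* Summing [dual] over all [j] gives [tr a * tr b = 1], which excludes [tr b = 0]. *)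
have tr_b : tr b = 1.
  have: tr a * tr b = 1.
    transitivity (\sum_(j < m.+1) (j == 0)%:R : F); last first.
      by rewrite (bigD1 0) //= big1 ?addr0 // => j /negPf->.
    under [RHS]eq_bigr do rewrite -dual.
    rewrite exchange_big /= mulrC mulr_suml; apply: eq_bigr => l _.
    by rewrite -mulr_sumr; congr (_ * _); apply: (reindex_inj (addrI l)).
  rewrite (tr01 b); case: eqP => // _ /eqP.
  by rewrite mulr0 eq_sym oner_eq0.
pose c (j k : 'I_m.+1) : nat := tr (a * frob j b * frob k b) == 1.
have cE j k : (c j k)%:R = tr (a * frob j b * frob k b) by rewrite [RHS]tr01.
have odd_inj k l : k%:R = l%:R :> F -> odd k = odd l.
  rewrite (natr_odd char2) [RHS](natr_odd char2).
  by case: odd; case: odd => //= /eqP; rewrite ?oner_eq0 // eq_sym oner_eq0.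
(* By [expand] the convolution collapses to a trace that is symmetric in [j], [k], [l]. *)
have c_conv j k l : (\sum_i c i l * c (j - i)%R (k - i)%R)%N%:R =
    tr (a * frob l b * frob j b * frob k b).
  transitivity (tr (a * frob l b *
    \sum_(i < m.+1) frob i b * tr (frob i a * (frob j b * frob k b)))).
    rewrite mulr_sumr tr_sum natr_sum; apply: eq_bigr => i _.
    rewrite natrM !cE -[X in _ * X](tr_frob i) !frobM -!Fadd !subrK.
    rewrite mulrC -trMl mulrC [in RHS]mulrA (mulrA (frob i a)).
    by rewrite [a * _ * _]mulrAC.
  by rewrite expand !mulrA.
(* The four conditions will give the meet commutativity, the unit 1, idempotence and associativity.
   The second rests on [tr b = 1], the third on [frob j b] having square [frob (j + Zp1) b]. *)
exists c; split=> [j k | j | j | j k l].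
- by rewrite /c mulrAC.
- rewrite -[RHS]oddb; apply: odd_inj; rewrite -pairing natr_sum.
  under eq_bigr do rewrite cE.
  by rewrite -tr_sum -mulr_sumr -[\sum_(i < _) _]/(tr b) tr_b mulr1.
- rewrite -[RHS]oddb; apply: odd_inj; rewrite cE -pairing -mulrA Fadd.
  by rewrite (frob_Zp1 expF).
by apply: odd_inj; rewrite !c_conv; congr tr; rewrite [RHS](ACl (1*4*2*3)).
Qed.

(** * The meet operation on a general ring *)

Lemma sum_symmetric_char2 (V : zmodType) (m : nat) (f : 'I_m -> 'I_m -> V) :
    (forall x : V, x + x = 0) -> (forall j k, f j k = f k j) ->
  \sum_j \sum_k f j k = \sum_j f j j.
Proof.
move=> char2 f_sym.
under eq_bigr => j _.
  rewrite (bigD1 j) //= (bigID (fun k : 'I_m => (k < j)%N)) /=; over.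
rewrite !big_split /= -[RHS]addr0; congr (_ + _).
(* In characteristic 2 the terms above the diagonal cancel those below, their mirror images under
   [f_sym]. *)
rewrite -[RHS](char2 (\sum_(j < m) \sum_(k < m | (k != j) && (k < j)%N) f j k)).
congr (_ + _); rewrite (exchange_big_dep xpredT) //=.
apply: eq_bigr => j _; apply: eq_big => [k | k _]; last exact: f_sym.
by rewrite -leqNgt (ltn_neqAle k j) val_eqE eq_sym andbA andbb.
Qed.

Section MeetOperation.

Variables (m : nat) (c : 'I_m.+1 -> 'I_m.+1 -> nat).
Hypotheses (c_sym : forall j k, c j k = c k j)
  (c_unit : forall j, odd (\sum_k c j k) = (j == 0))
  (c_diag : forall j, odd (c j j) = (j + Zp1 == 0))
  (c_assoc : forall j k l, odd (\sum_i c i l * c (j - i)%R (k - i)%R) =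
                           odd (\sum_i c i j * c (k - i)%R (l - i)%R)).

Variable R : comPzRingType.
Hypotheses (char2 : forall x : R, x + x = 0)
  (expR : forall x : R, x ^+ (2 ^ m.+1) = x).

Definition frob_meet (x y : R) : R :=
  \sum_j \sum_k (frob (j : 'I_m.+1) x * frob (k : 'I_m.+1) y) *+ c j k.

Lemma frob_meetC : commutative frob_meet.
Proof.
move=> x y; rewrite /frob_meet exchange_big; apply: eq_bigr => j _.
by apply: eq_bigr => k _; rewrite mulrC c_sym.
Qed.

Lemma frob_meetDl : left_distributive frob_meet +%R.
Proof.
move=> x y z; rewrite -big_split; apply: eq_bigr => j _.
rewrite -big_split; apply: eq_bigr => k _.
by rewrite (frobD char2) mulrDl mulrnDl.
Qed.

Lemma sum_frob_delta (i0 : 'I_m.+1) (f : 'I_m.+1 -> R) :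
  \sum_i f i *+ (i == i0) = f i0.
Proof.
by rewrite (bigD1 i0) //= eqxx big1 ?addr0 // => i /negPf->.
Qed.

(** Only the terms with [j = k] survive, by symmetry; [c_diag] selects [j = - Zp1] among them, where
    the square of [frob j x] is [x]. *)
Lemma frob_meetxx : idempotent_op frob_meet.
Proof.
move=> x; rewrite /frob_meet sum_symmetric_char2 // => [|j k]; last first.
  by rewrite mulrC c_sym.
transitivity (\sum_(j < m.+1) frob (j + Zp1)%R x *+ (j == - Zp1)).
  apply: eq_bigr => j _; rewrite (mulrn_odd char2) c_diag addr_eq0.
  by rewrite (frob_add expR) frob_Zp1.
by rewrite sum_frob_delta addNr /frob expn0 expr1.
Qed.

Lemma frob_meet1x : left_id 1 frob_meet.
Proof.
move=> y; rewrite /frob_meet exchange_big.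
transitivity (\sum_(k < m.+1) frob k y *+ (k == 0)).
  apply: eq_bigr => k _; rewrite -c_unit -(mulrn_odd char2) -sumrMnr.
  by apply: eq_bigr => j _; rewrite frob1 mul1r c_sym.
by rewrite sum_frob_delta /frob expn0 expr1.
Qed.

(** Applying [frob i] to the inner meet shifts both its indices by [i]; translating them back moves
    the shift into the arguments of [c]. *)
Lemma frob_meet_meet x y z : frob_meet (frob_meet x y) z =
  \sum_(j < m.+1) \sum_(k < m.+1) \sum_(l < m.+1)
    (frob j x * frob k y * frob l z) *+
      (\sum_i c i l * c (j - i)%R (k - i)%R)%N.
Proof.
transitivity (\sum_(l < m.+1) \sum_(i < m.+1) \sum_(j < m.+1) \sum_(k < m.+1)
    (frob j x * frob k y * frob l z) *+ (c i l * c (j - i)%R (k - i)%R)%N).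
  rewrite [LHS]exchange_big; apply: eq_bigr => l _; apply: eq_bigr => i _.
  rewrite (frob_sum char2) mulr_suml -sumrMnl (reindex_inj (addIr (- i))).
  apply: eq_bigr => j _.
  rewrite (frob_sum char2) mulr_suml -sumrMnl (reindex_inj (addIr (- i))).
  apply: eq_bigr => k _.
  rewrite (frobMn char2) frobM -!(frob_add expR) !subrK.
  by rewrite mulrnAl -mulrnA mulnC.
apply/esym; under eq_bigr do rewrite exchange_big /=.
rewrite exchange_big; apply: eq_bigr => l _ /=.
rewrite [RHS]exchange_big; apply: eq_bigr => j _ /=.
rewrite [RHS]exchange_big; apply: eq_bigr => k _ /=.
by rewrite sumrMnr.
Qed.

(** After one use of commutativity both sides are expanded by [frob_meet_meet]; their coefficients
    differ by a cyclic rotation of the indices, the case covered by [c_assoc]. *)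
Lemma frob_meetA : associative frob_meet.
Proof.
move=> x y z; rewrite frob_meetC !frob_meet_meet.
under eq_bigr do rewrite exchange_big /=.
rewrite exchange_big; apply: eq_bigr => p _ /=; apply: eq_bigr => q _.
apply: eq_bigr => r _.
rewrite (mulrn_odd char2) [RHS](mulrn_odd char2) [in RHS]c_assoc.
by congr (_ *+ _); rewrite mulrC mulrA.
Qed.

End MeetOperation.

(** * Closure properties of term operations *)

Section TermOperations.

Variable R : pzRingType.
Implicit Types f g : R -> R -> R.

Lemma term_operationX f n :
    is_binary_term_operation f ->
  is_binary_term_operation (fun x y => f x y ^+ n).
Proof.
move=> [t Dt]; elim: n => [|n [u Du]]; first by exists TOne.
by exists (TMul t u) => x y; rewrite /= -Dt -Du exprS.
Qed.

Lemma term_operationM f g :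
    is_binary_term_operation f -> is_binary_term_operation g ->
  is_binary_term_operation (fun x y => f x y * g x y).
Proof.
by move=> [t Dt] [u Du]; exists (TMul t u) => x y; rewrite /= -Dt -Du.
Qed.

Lemma term_operationMn f n :
    is_binary_term_operation f ->
  is_binary_term_operation (fun x y => f x y *+ n).
Proof.
move=> [t Dt]; elim: n => [|n [u Du]]; first by exists TZero.
by exists (TAdd t u) => x y; rewrite /= -Dt -Du mulrS.
Qed.

Lemma term_operation_sum I (r : seq I) (f : I -> R -> R -> R) :
    (forall i, is_binary_term_operation (f i)) ->
  is_binary_term_operation (fun x y => \sum_(i <- r) f i x y).
Proof.
move=> term_f; elim: r => [|i r [u Du]].
  by exists TZero => x y; rewrite big_nil.
have [t Dt] := term_f i.
by exists (TAdd t u) => x y; rewrite /= -Dt -Du big_cons.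
Qed.

End TermOperations.

Lemma frob_meet_term_operation (m : nat) (c : 'I_m.+1 -> 'I_m.+1 -> nat)
  (R : comPzRingType) : is_binary_term_operation (@frob_meet m c R).
Proof.
apply: term_operation_sum => j; apply: term_operation_sum => k.
apply: term_operationMn; apply: term_operationM; apply: term_operationX.
  by exists (TVar ord0).
by exists (TVar (lift ord0 ord0)).
Qed.

(** * From Boolean rings to Boolean algebras *)

Lemma boolean_ring_is_boolean_algebra (V : zmodType) (meet : V -> V -> V)
    (one : V) :
    (forall x : V, x + x = 0) -> commutative meet -> associative meet ->
    left_distributive meet +%R -> idempotent_op meet -> left_id one meet ->
  is_boolean_algebra (fun x y => x + y + meet x y) meet (fun x => x + one)
    0 one.
Proof.
move=> char2 meetC meetA meetDl meetxx meet1x.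
pose join x y := x + y + meet x y.
have meetDr x y z : meet x (y + z) = meet x y + meet x z.
  by rewrite meetC meetDl !(meetC x).
have addKK (x y : V) : x + (x + y) = y by rewrite addrA char2 add0r.
have meetKr x y : meet x (meet x y) = meet x y by rewrite meetA meetxx.
have meetx0 x : meet x 0 = 0.
  by apply: (addrI (meet x 0)); rewrite -meetDr !addr0.
have joinC : commutative join by move=> x y; rewrite /join (addrC x) meetC.
have joinA : associative join.
  move=> x y z; rewrite /join !meetDr !meetDl meetA !addrA.
  by rewrite [LHS](ACl (1*2*5*3*6*4*7)).
have joinKI y x : meet x (join x y) = x.
  by rewrite /join !meetDr meetxx meetKr -addrA char2 addr0.
have meetKU y x : join x (meet x y) = x.
  by rewrite /join meetKr -addrA char2 addr0.
have meetUl : left_distributive meet join.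
  move=> x y z; rewrite /join !meetDl; congr (_ + _).
  by rewrite (meetC y z) -(meetA x z) meetKr (meetC z) meetA.
(* The two [erefl] fix the order: [x <= y] means [meet x y = x], and [<] is its strict part. *)
pose lattice := @Order.isMeetJoinDistrLattice.Build (Order.Disp tt tt) V
  _ _ _ _ (fun _ _ => erefl) (fun _ _ => erefl)
  meetC joinC meetA joinA joinKI meetKU meetUl meetxx.
pose D : distrLatticeType _ := HB.pack (V : Type) (Choice.on V) lattice.
have bot_le (x : D) : (0 <= x :> D)%O by apply/eqP; rewrite /= meetC meetx0.
have le_top (x : D) : (x <= one :> D)%O by apply/eqP; rewrite /= meetC meet1x.
pose bot := Order.hasBottom.Build _ D bot_le.
pose top := Order.hasTop.Build _ D le_top.
pose B : tbDistrLatticeType _ := HB.pack (V : Type) D bot top.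
have joinxC (x : B) : (x `|` (x + one : V) = \top :> B)%O.
  rewrite /Order.join /= /join meetDr meetxx (meetC x) meet1x char2 addr0.
  by rewrite addKK.
have meetxC (x : B) : (x `&` (x + one : V) = \bot :> B)%O.
  by rewrite /Order.meet /= meetDr meetxx (meetC x) meet1x char2.
pose compl := Order.TBDistrLattice_hasComplement.Build _ B joinxC meetxC.
pose L : ctbDistrLatticeType _ := HB.pack (V : Type) B compl.
by exists (Order.Disp tt tt), (Order.CTBDistrLattice.class L).
Qed.

Theorem theorem4p8 (n : nat) (n_ge1 : (1 <= n)%N) (R : comPzRingType)
    (char2 : forall x : R, x + x = 0)
    (expR : forall x : R, x ^+ (2 ^ n) = x) :
  exists meet : R -> R -> R,
    is_binary_term_operation meet /\
    is_boolean_algebra (fun x y : R => x + y + meet x y) meet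
      (fun x : R => x + 1) 0 1.
Proof.
(* With [n = m.+1] the indices ['I_m.+1] form the cyclic group of order [n]. *)
case: n n_ge1 expR => // m _ expR.
have [c [c_sym c_unit c_diag c_assoc]] := exists_meet_coefficients m.
exists (@frob_meet m c R); split; first exact: frob_meet_term_operation.
apply: boolean_ring_is_boolean_algebra => //.
- exact: frob_meetC.
- exact: frob_meetA.
- exact: frob_meetDl.
- exact: frob_meetxx.
- exact: frob_meet1x.
Qed.
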